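(* Let $n$ and $r$ be positive integers. Then for a fixed value of $r$ and sufficiently large $n$, the following hold. (a) $$P(n,rn)=\frac{1}{n}+\frac{c(r)}{n^2}+O\left(\frac{1}{n^{2.5-o(1)}}\right),$$ where $c(r)=\sum\left(1+\frac{i+j}{2r}\right)$ and the sum is over all pairs $(i,j)$ such that $1\leq i,j\leq r^2$, $ij=r^2$, and both $r+i$ and $r+j$ divide $rn$. In particular $c(1)=0$ if $n$ is odd, and $c(1)=2$ if $n$ is even. (b) If $r=t!-1$ and $m=t!(n-t)=(r+1)n-t\cdot t!$, then $$P(n,m)=\frac{1}{n}+\frac{t+c'(r)}{n^2}+O\left(\frac{1}{n^{2.5-o(1)}}\right),$$ where $c'(r)=\sum\left(1+\frac{i+j-2}{2(r+1)}\right)$ and the sum is over all pairs $(i,j)$ such that $1<i,j\leq (r+1)^2$, $(i-1)(j-1)=(r+1)^2$, and both $r+i$ and $r+j$ divide $m$.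
   Context: For positive integers $n,m$, $P(n,m)$ denotes the proportion of permutations $g$ in the symmetric group $S_n$ on $n$ points which satisfy $g^m=1$, that is, whose order divides $m$. In the sums, $(i,j)$ ranges over ordered pairs of integers, and in part (b) $t$ is a positive integer. The asymptotic notation is for $n\to\infty$ with $r$ fixed.
   Formalization: In (b) the sum c'(r) runs over 1 < i,j ≤ (r+1)²+1 instead of (r+1)²; the printed bound drops the pairs {2,(r+1)²+1}, and (b) then fails, e.g. for t=2, r=1, n≡2 mod 3, by about 4.5/n². *)

(* Defs.v *)
From mathcomp Require Import all_boot all_order all_algebra all_fingroup.
From mathcomp Require Import all_classical all_reals all_analysis.

Set Implicit Arguments.
Unset Strict Implicit.
Unset Printing Implicit Defensive.

Import Order.TTheory GRing.Theory Num.Theory.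
Import numFieldNormedType.Exports.

Local Open Scope ring_scope.

Definition P (R : realType) (n m : nat) : R :=
  #|[set g : 'S_n | (g ^+ m == 1)%g]|%:R / #|{: 'S_n}|%:R.

Definition c (R : realType) (r n : nat) : R :=
  \sum_(1 <= i < (r ^ 2).+1)
    \sum_(1 <= j < (r ^ 2).+1 |
        [&& i * j == r ^ 2, r + i %| r * n & r + j %| r * n]%N)
      (1 + (i%:R + j%:R) / (2 * r%:R)).

(* Here i and j run up to (r + 1)^2 + 1, so that every factorisation
   (i - 1)(j - 1) = (r + 1)^2 is considered.  The source bounds i and j by
   (r + 1)^2, which drops the pairs {i, j} = {2, (r + 1)^2 + 1}.  With
   m = (r + 1)(n - t) these satisfy the divisibility conditions exactly when
   r + 2 divides n - t (for n > t), and then permutations with cycles of lengths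
   m / (r + 2) and m / ((r + 1)(r + 2)), and t further points, do contribute to
   the n^-2 term of P n m: the expansion with the smaller bound fails for
   such n. *)
Definition c' (R : realType) (r m : nat) : R :=
  \sum_(2 <= i < ((r + 1) ^ 2).+2)
    \sum_(2 <= j < ((r + 1) ^ 2).+2 |
        [&& (i - 1) * (j - 1) == (r + 1) ^ 2, r + i %| m & r + j %| m]%N)
      (1 + (i%:R + j%:R - 2) / (2 * (r%:R + 1))).

Local Open Scope classical_set_scope.
Local Open Scope ring_scope.

(* f n = O (1 / n ^ (a - o(1))) as n tends to infinity. *)
Definition bigO_inv_powR_subo (R : realType) (a : R) (f : nat -> R) : Prop :=
  exists2 e : nat -> R, e =o_\oo (fun=> 1 : R) &
    f =O_\oo (fun n => 1 / (n%:R `^ (a - e n))).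

(* Main.v *)
(** For [m] fixed let [p k] be the proportion of [g] in ['S_k] with [g ^+ m =
   1]. Summing over the length [d] of the cycle of a given point, k p(k) =
   \sum_(d | m, d <= k) p(k - d). Both parts concern [m = s (n - t)] with [t!
   | s]: (a) is [s = r], [t = 0] and (b) is [s = r + 1]. For large [n] the
   divisors [d <= n] of [m] are [d = n - t], which contributes [p t = 1], and
   the [d = m / a] with [a > s], for which [n - d] is of order [n]. Applying
   the recursion to the latter once more gives the terms [p (n - d - e) / (n
   - d)]. They are of order [1 / n] when [e = n - t], which leaves the [t]
   values [d <= t], and when [d + e = n - t], that is [1/a + 1/b = 1/s] with
   [e = m / b]; this last equation reads [(a - s)(b - s) = s ^ 2] and yields
   the constants [c] and [c']. For all other pairs [n - d - e] is at least a
   constant times [n], and [p k <= tau(m) / k], where [tau] counts divisors.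
   Hence the error is [O(tau(m) ^ 3 / n ^ 3)], and [tau(m) ^ 6 = O(m)] makes
   it [O(n ^ (- 5 / 2))]: one can take [o(1) = 0]. *)
Require Import Defs.
From mathcomp Require Import all_boot all_order all_algebra all_fingroup.
From mathcomp Require Import cyclic.

Set Implicit Arguments.
Unset Strict Implicit.
Unset Printing Implicit Defensive.

(** * Permutations and the cycle of a point *)

Lemma porbit_stable (T : finType) (s : {perm T}) (x z : T) :
  z \in porbit s x -> s z \in porbit s x.
Proof. by move=> /porbitP[i ->]; rewrite -permM -expgSr mem_porbit. Qed.

Lemma porbit_sub_stable (T : finType) (s : {perm T}) (B : {set T}) (x : T) :
  x \in B -> {in B, forall z, s z \in B} -> porbit s x \subset B.
Proof.
move=> xB sB; apply/subsetP=> _ /porbitP[i ->].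
by elim: i => [|i IHi]; rewrite ?perm1 // expgSr permM sB.
Qed.

(* [tperm x y * h] inserts the fixed point [y] of [h] into the cycle of [x],
   just after [x]. *)
Lemma porbit_tpermM (T : finType) (h : {perm T}) (x y : T) :
  x != y -> h y = y -> porbit (tperm x y * h)%g x = y |: porbit h x.
Proof.
move=> xy hy; set g := (_ * _)%g.
have gx : g x = y by rewrite permM tpermL.
have gy : g y = h x by rewrite permM tpermR.
have gz z : z != x -> z != y -> g z = h z.
  by move=> zx zy; rewrite permM tpermD // eq_sym.
apply/eqP; rewrite eqEsubset; apply/andP; split.
  apply: porbit_sub_stable; first by rewrite !inE porbit_id orbT.
  move=> z; have [->|zx] := eqVneq z x; first by rewrite gx setU11.
  have [->|zy] := eqVneq z y.
    by rewrite gy !inE porbit_stable ?porbit_id ?orbT.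
  by rewrite gz // !inE (negPf zy) => /= zO; rewrite porbit_stable ?orbT.
rewrite subUset sub1set -{1}gx porbit_stable ?porbit_id //=.
apply: porbit_sub_stable; first exact: porbit_id.
move=> z zO; have [->|zx] := eqVneq z x.
  by rewrite -gy -gx !porbit_stable // porbit_id.
have [->|zy] := eqVneq z y; first by rewrite hy -gx porbit_stable ?porbit_id.
by rewrite -gz // porbit_stable.
Qed.

Lemma expg_porbit_dvdn (T : finType) (s : {perm T}) (x : T) (m : nat) :
  ((s ^+ m)%g x == x) = (#|porbit s x| %| m).
Proof.
have sp1 : (s ^+ #|porbit s x|)%g x = x by rewrite permX iter_porbit.
set p := #|_| in sp1 *.
have p_gt0 : 0 < p by rewrite lt0n card_porbit_neq0.
have sp k : (s ^+ (k * p))%g x = x.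
  elim: k => [|k IHk]; first by rewrite perm1.
  by rewrite mulSn expgD permM sp1.
rewrite {1}(divn_eq m p) expgD permM sp /dvdn permX.
have r_lt : m %% p < p by rewrite ltn_mod.
(* The first [p] iterates of [x] are distinct, so the remainder of [m] modulo [p] sends [x] to
   itself only if it is 0. *)
have := nth_uniq x (i := m %% p) (j := 0) _ _ (uniq_traject_porbit s x).
rewrite !size_traject => /(_ r_lt p_gt0) <-.
by rewrite !nth_traject.
Qed.

(** The part of the condition [g ^+ m = 1] that does not involve the cycle of [x]; it survives when
    that cycle is lengthened or shortened. *)
Definition expg_fixes_off_porbit {T : finType} (m : nat) (x : T)
    (g : {perm T}) : bool :=
  [forall z, (z \notin porbit g x) ==> ((g ^+ m)%g z == z)].

Lemma expg_eq1_porbit (T : finType) (m : nat) (x : T) (g : {perm T}) :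
  ((g ^+ m)%g == 1%g) = (#|porbit g x| %| m) && expg_fixes_off_porbit m x g.
Proof.
apply/idP/andP=> [/eqP gm|[gx /forallP goff]].
  rewrite -expg_porbit_dvdn gm perm1; split=> //.
  by apply/forallP=> z; rewrite gm perm1 eqxx implybT.
apply/eqP/permP=> z; rewrite perm1; apply/eqP.
have [zO|zO] := boolP (z \in porbit g x); last exact: implyP (goff z) zO.
rewrite expg_porbit_dvdn; suff <- : porbit g x = porbit g z by [].
by apply/eqP; rewrite eq_porbit_mem porbit_sym.
Qed.

(** Inserting [y] changes only the cycle of [x]: off the enlarged cycle both permutations have the
    same iterates, and [h ^+ m] fixes [y] anyway. *)
Lemma expg_fixes_off_porbit_tpermM (T : finType) (m : nat) (h : {perm T})
    (x y : T) :
  x != y -> h y = y ->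
  expg_fixes_off_porbit m x (tperm x y * h)%g = expg_fixes_off_porbit m x h.
Proof.
move=> xy hy; have hyX i : (h ^+ i)%g y = y.
  by elim: i => [|i IHi]; rewrite ?perm1 // expgSr permM IHi.
apply: eq_forallb => z; rewrite porbit_tpermM // inE negb_or inE.
have [->|zy] /= := eqVneq z y; first by rewrite hyX eqxx implybT.
have [//|zO] /= := boolP (z \in porbit h x).
suff -> : ((tperm x y * h) ^+ m)%g z = (h ^+ m)%g z by [].
elim: m => // i IHi; rewrite !expgSr !permM IHi tpermD //.
  apply: contraNneq zO => hz; rewrite porbit_sym; apply/porbitP.
  by exists i.
by apply: contra_neq zy => hz; apply: (@perm_inj _ (h ^+ i)%g); rewrite hyX.
Qed.

(** * Counting by the length of the cycle of a point *)

Definition nb_exp {T : finType} (A : {set T}) (m : nat) : nat :=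
  #|[set g : {perm T} | perm_on A g & (g ^+ m == 1)%g]|.

(** Divisibility of [m] by [d] is not imposed, so that [d] can decrease one point at a time.
    Supports in [A] let points be removed without changing the type. *)
Definition nb_exp_porbit {T : finType} (A : {set T}) (m : nat) (x : T)
    (d : nat) : nat :=
  #|[set g : {perm T} | [&& perm_on A g, #|porbit g x| == d
                          & expg_fixes_off_porbit m x g]]|.

Lemma perm_on_setD1 (T : finType) (A : {set T}) (y : T) (h : {perm T}) :
  perm_on (A :\ y) h = perm_on A h && (h y == y).
Proof.
apply/subsetP/andP=> [hA|[/subsetP hA hy] z zh].
  split; first by apply/subsetP=> z /hA; rewrite !inE => /andP[].
  by apply/negPn/negP=> /hA; rewrite !inE eqxx.
rewrite !inE hA // andbT; apply: contraTneq zh => ->.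
by rewrite !inE hy.
Qed.

Lemma nb_exp_porbit1 (T : finType) (A : {set T}) (m : nat) (x : T) :
  nb_exp_porbit A m x 1 = nb_exp (A :\ x) m.
Proof.
rewrite /nb_exp_porbit /nb_exp; apply: eq_card => g; rewrite !inE.
rewrite perm_on_setD1 -andbA; congr (_ && _).
have -> : (#|porbit g x| == 1) = (g x == x).
  by rewrite -(expg1 g) expg_porbit_dvdn dvdn1 expg1.
have [gx|//] := eqVneq (g x) x.
rewrite (expg_eq1_porbit m x) (_ : #|_| = 1) ?dvd1n //.
by apply/eqP; rewrite -dvdn1 -expg_porbit_dvdn expg1 gx.
Qed.

(** Sort the permutations by [y = g x], for which there are [#|A|.-1] choices. Writing
    [g = tperm x y * h] removes [y] from the cycle of [x] and leaves an [h] supported on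
    [A :\ y]. *)
Lemma nb_exp_porbitS (T : finType) (A : {set T}) (m : nat) (x : T) (d k : nat) :
  x \in A -> 0 < d ->
  (forall y, y \in A :\ x -> nb_exp_porbit (A :\ y) m x d = k) ->
  nb_exp_porbit A m x d.+1 = #|A|.-1 * k.
Proof.
move=> xA d_gt0 IH; rewrite {1}/nb_exp_porbit -sum1_card.
rewrite (partition_big (fun g : {perm T} => g x) (mem (A :\ x))) /=; last first.
  move=> g; rewrite !inE => /and3P[gA gd _]; rewrite perm_closed // xA andbT.
  apply: contraTneq gd => gx; suff -> : #|porbit g x| = 1 by case: d d_gt0 {IH}.
  by apply/eqP; rewrite -dvdn1 -expg_porbit_dvdn expg1 gx.
rewrite (cardsD1 x A) xA /= -sum_nat_const; apply: eq_bigr => y yAx.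
rewrite -(IH y yAx) /nb_exp_porbit -[RHS]sum1_card.
rewrite (reindex_inj (mulgI (tperm x y))) /=; apply: eq_bigl => h.
move: yAx; rewrite !inE => /andP[yx yA]; rewrite permM tpermL perm_on_setD1.
have [hy|] := eqVneq (h y) y; last by rewrite !andbF.
rewrite !andbT expg_fixes_off_porbit_tpermM 1?eq_sym //.
rewrite porbit_tpermM 1?eq_sym // cardsU1.
have -> : y \notin porbit h x.
  rewrite porbit_sym; apply/negP=> /porbitP[i xE].
  suff : x = y by apply/eqP; rewrite eq_sym.
  by rewrite xE; elim: i {xE} => [|i IHi]; rewrite ?perm1 // expgSr permM IHi.
rewrite add1n eqSS; congr (_ && _).
have txy : perm_on A (tperm x y).
  apply/subsetP=> z; rewrite inE; case: tpermP => [->|->|_ _] //.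
  by rewrite eqxx.
apply/idP/idP=> hA; last exact: perm_onM.
by rewrite -[h]mul1g -(tperm2 x y) -mulgA perm_onM.
Qed.

(** The falling factorial counts the ordered choices of the other [d] points of the cycle; the
    remaining points carry any permutation counted by [f]. *)
Lemma nb_exp_porbitE (T : finType) (A : {set T}) (m : nat) (x : T) (d : nat)
    (f : nat -> nat) :
  x \in A -> (forall B : {set T}, #|B| < #|A| -> nb_exp B m = f #|B|) ->
  d < #|A| -> nb_exp_porbit A m x d.+1 = #|A|.-1 ^_ d * f (#|A|.-1 - d).
Proof.
elim: d A => [|d IHd] A xA fA dA.
  rewrite nb_exp_porbit1 fA; last by rewrite (cardsD1 x A) xA.
  by rewrite (cardsD1 x A) xA ffactn0 mul1n subn0.
have A1 y : y \in A :\ x -> #|A :\ y| = #|A|.-1.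
  by rewrite !inE (cardsD1 y A) => /andP[_ ->].
rewrite (nb_exp_porbitS (k := #|A|.-2 ^_ d * f (#|A|.-2 - d))) //.
  case: #|A| dA => [|[|a]] //= dA.
  by rewrite mulnA -ffactnS subSS.
move=> y yAx; rewrite IHd ?A1 //.
- by move: yAx; rewrite !inE xA andbT eq_sym => /andP[].
- by move=> B BA; rewrite fA // (leq_trans BA) ?leq_pred.
- by case: #|A| dA.
Qed.

(** Sort by the length of the cycle of a point of [A]. That the count depends on cardinality alone
    is assumed only for smaller sets, so that the recursion can serve in the induction proving
    it. *)
Lemma nb_exp_rec (T : finType) (A : {set T}) (m : nat) (f : nat -> nat) :
  0 < #|A| -> (forall B : {set T}, #|B| < #|A| -> nb_exp B m = f #|B|) ->
  nb_exp A m =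
    \sum_(d < #|A| | d.+1 %| m) #|A|.-1 ^_ d * f (#|A|.-1 - d).
Proof.
case/card_gt0P=> x xA fA; have orbP g : perm_on A g -> #|porbit g x| <= #|A|.
  move=> gA; apply/subset_leq_card/porbit_sub_stable => // z zA.
  by rewrite perm_closed.
have -> : nb_exp A m = \sum_(d < #|A|.+1 | d %| m) nb_exp_porbit A m x d.
  rewrite {1}/nb_exp -sum1_card.
  pose F (g : {perm T}) : 'I_(#|A|.+1) := inord #|porbit g x|.
  have FE g : perm_on A g -> F g = #|porbit g x| :> nat.
    by move=> gA; rewrite inordK // ltnS orbP.
  rewrite (partition_big F (fun d : 'I_(#|A|.+1) => d %| m)) /=; last first.
    move=> g; rewrite inE (expg_eq1_porbit m x) => /and3P[gA gm _].
    by rewrite FE.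
  apply: eq_bigr => d dm; rewrite /nb_exp_porbit -[RHS]sum1_card.
  apply: eq_bigl => g; rewrite !inE.
  have [gA|//] := boolP (perm_on A g).
  rewrite (expg_eq1_porbit m x) -val_eqE /=.
  by rewrite FE //; case: eqP => [->|]; rewrite ?dm ?andbT ?andbF.
(* No cycle has length 0, so that index drops out even when [m = 0]; the others are shifted by
   one. *)
rewrite big_mkcond big_ord_recl /= [X in X + _](_ : _ = 0) ?add0n; last first.
  case: ifP => // _; apply/eqP; rewrite cards_eq0; apply/eqP/setP=> g.
  by rewrite !inE (negPf (card_porbit_neq0 _ _)) andbF.
rewrite [RHS]big_mkcond; apply: eq_bigr => d _; rewrite /bump /= add1n.
by rewrite (nb_exp_porbitE xA fA).
Qed.

(** By strong induction on [#|A|] over all types, both sides obey the recursion [nb_exp_rec]; no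
    bijection from [A] to an ordinal has to be transported. *)
Lemma nb_expE (T : finType) (A : {set T}) (m : nat) :
  nb_exp A m = #|[set g : 'S_(#|A|) | (g ^+ m == 1)%g]|.
Proof.
have nbT k : #|[set g : 'S_k | (g ^+ m == 1)%g]| = nb_exp [set: 'I_k] m.
  apply: eq_card => g.
  by rewrite !inE [perm_on _ _](introT subsetP) ?andTb // => z.
have [n] := ubnP #|A|; elim: n T A => // n IHn T A /ltnSE leAn.
have [A0|A_gt0] := posnP #|A|.
  have nb0 (U : finType) (B : {set U}) : #|B| = 0 -> nb_exp B m = 1.
    move=> B0; rewrite -(cards1 (1%g : {perm U})); apply: eq_card => g.
    rewrite !inE; apply/andP/eqP=> [[gB _]|->]; last by rewrite perm_on1 expg1n.
    by apply: perm_on_id gB _; rewrite B0.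
  by rewrite nbT !nb0 ?cardsT ?card_ord.
pose f k := #|[set g : 'S_k | (g ^+ m == 1)%g]|.
have fE (U : finType) (B : {set U}) : #|B| < #|A| -> nb_exp B m = f #|B|.
  by move=> BA; apply: IHn; apply: leq_trans BA _.
rewrite nbT (nb_exp_rec (f := f)) //; last by move=> B; apply: fE.
have cT : #|[set: 'I_#|A|]| = #|A| by rewrite cardsT card_ord.
rewrite (nb_exp_rec (A := [set: 'I_#|A|]) (f := f)) ?cT //.
by move=> B; apply: fE.
Qed.

Lemma card_expg_eq1_rec (n m : nat) :
  #|[set g : 'S_n.+1 | (g ^+ m == 1)%g]| =
    \sum_(d < n.+1 | d.+1 %| m)
      n ^_ d * #|[set g : 'S_(n - d) | (g ^+ m == 1)%g]|.
Proof.
have := nb_exp_rec (A := [set: 'I_n.+1]) (m := m)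
          (f := fun k => #|[set g : 'S_k | (g ^+ m == 1)%g]|).
rewrite !nb_expE cardsT card_ord; apply=> // B _; exact: nb_expE.
Qed.

(** * The divisor function *)

(** Every divisor [d] of [a * b] is the product of [gcdn d a], which divides [a], and
    [d %/ gcdn d a], which divides [b] by Gauss. *)
Lemma size_divisorsM (a b : nat) : 0 < a -> 0 < b ->
  size (divisors (a * b)) <= size (divisors a) * size (divisors b).
Proof.
move=> a0 b0; rewrite -(size_allpairs muln); apply: uniq_leq_size.
  exact: divisors_uniq.
move=> d; rewrite -dvdn_divisors ?muln_gt0 ?a0 // => dab.
have g0 : 0 < gcdn d a by rewrite gcdn_gt0 a0 orbT.
apply/allpairsP; exists (gcdn d a, d %/ gcdn d a) => /=.
rewrite -!dvdn_divisors // dvdn_gcdr; split=> //; last first.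
  by rewrite mulnC divnK ?dvdn_gcdl.
have co : coprime (d %/ gcdn d a) (a %/ gcdn d a).
  rewrite /coprime -(eqn_pmul2r g0) muln_gcdl.
  by rewrite !divnK ?dvdn_gcdl ?dvdn_gcdr ?mul1n.
rewrite -(Gauss_dvdr b co) -(dvdn_pmul2r g0) divnK ?dvdn_gcdl //.
by rewrite mulnAC divnK ?dvdn_gcdr.
Qed.

Lemma size_divisors_pfactor (p a : nat) : prime p ->
  size (divisors (p ^ a)) <= a.+1.
Proof.
move=> p_pr; rewrite -(size_mkseq (fun i => p ^ i) a.+1).
apply: uniq_leq_size (divisors_uniq _) _ => d.
rewrite -dvdn_divisors ?expn_gt0 ?prime_gt0 // => /dvdn_pfactor[] // i ia ->.
by apply/mapP; exists i; rewrite // mem_iota ltnS.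
Qed.

(** With [j = a %/ k], one has [a + 1 <= k (j + 1) <= k 2^j]; then raise to the power [k]. *)
Lemma succ_exp_le (k a : nat) : 0 < k -> a.+1 ^ k <= k ^ k * 2 ^ a.
Proof.
move=> k0; have aq : a.+1 <= k * 2 ^ (a %/ k).
  apply: leq_trans (_ : k * (a %/ k).+1 <= _); last first.
    by rewrite leq_mul2l ltn_expl // orbT.
  by rewrite mulnC ltn_ceil.
apply: leq_trans (_ : (k * 2 ^ (a %/ k)) ^ k <= _); first by rewrite leq_exp2r.
by rewrite expnMn leq_mul2l -expnM leq_exp2l // leq_divM orbT.
Qed.

(* Prime divisors [p >= 2 ^ k] are harmless, since a factor [p ^ a] multiplies
   the number of divisors by [a.+1 <= 2 ^ a]; each of the finitely many smaller
   primes only costs a constant factor. *)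
Lemma size_divisors_exp_le (k : nat) : 0 < k ->
  exists K, forall m, 0 < m -> size (divisors m) ^ k <= K * m.
Proof.
move=> k0.
suff [K KP] : exists K, forall m, 0 < m ->
    (forall p, prime p -> p %| m -> (p < 2 ^ k) || (2 ^ k <= p)) ->
    size (divisors m) ^ k <= K * m.
  by exists K => m m0; apply: KP => // p _ _; case: ltnP.
(* Only the first bound is generalised: the induction is on [q], for those [m] whose prime divisors
   are below [q] or at least [2 ^ k]. *)
elim: {1}(2 ^ k) => [|q [K KP]].
  exists 1; elim/ltn_ind=> m IHm m0 pm; rewrite mul1n.
  have [->|m1] := eqVneq m 1; first by rewrite exp1n.
  have p_pr : prime (pdiv m) by rewrite pdiv_prime // ltn_neqAle eq_sym m1.
  have pm' : pdiv m * (m %/ pdiv m) = m by rewrite mulnC divnK ?pdiv_dvd.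
  have p_ge := pm _ p_pr (pdiv_dvd m); rewrite /= in p_ge.
  have m'0 : 0 < m %/ pdiv m by rewrite divn_gt0 ?pdiv_gt0 // pdiv_leq.
  have {}IHm : size (divisors (m %/ pdiv m)) ^ k <= m %/ pdiv m.
    rewrite -[leqRHS]mul1n IHm ?ltn_Pdiv ?prime_gt1 // => p p_prime pd.
    by apply: pm => //; apply: dvdn_trans pd _; apply/dvdnP; exists (pdiv m).
  rewrite -{2}pm'; apply: leq_trans (leq_mul p_ge IHm).
  rewrite -expnMn leq_exp2r // -{1}pm'.
  apply: leq_trans (size_divisorsM (prime_gt0 p_pr) m'0) _.
  by apply: leq_mul => //; apply: (size_divisors_pfactor 1 p_pr).
have [q_pr|q_npr] := boolP (prime q); last first.
  exists K => m m0 pm; apply: KP => // p p_pr pdm.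
  move: (pm p p_pr pdm); rewrite ltnS leq_eqVlt -orbA => /orP[/eqP pq|//].
  by rewrite -pq p_pr in q_npr.
(* The [q]-part of [m] costs the factor [k ^ k] of [succ_exp_le]; the prime divisors of the
   [q']-part satisfy the previous hypothesis. *)
exists (k ^ k * K) => m m0 pm; rewrite -{1}(partnC q m0).
apply: leq_trans (_ : (size (divisors m`_q) * size (divisors m`_q^')) ^ k <= _).
  by rewrite leq_exp2r ?size_divisorsM ?part_gt0.
rewrite expnMn -[in leqRHS](partnC q m0) mulnACA leq_mul //.
  rewrite p_part; apply: leq_trans (_ : (logn q m).+1 ^ k <= _).
    by rewrite leq_exp2r ?size_divisors_pfactor.
  apply: leq_trans (succ_exp_le _ k0) _.
  rewrite leq_mul2l; case: (logn q m) => [|a]; rewrite ?leqnn ?orbT //.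
  by rewrite leq_exp2r ?prime_gt1 ?orbT.
apply: KP; first exact: part_gt0.
move=> p p_pr pd; have /andP[pm' pq] : (p %| m) && (p \in q^').
  rewrite (dvdn_trans pd (dvdn_part _ _)) /=.
  by apply: pnatPpi (part_pnat q^' m) _; rewrite mem_primes p_pr part_gt0.
move: (pm p p_pr pm'); rewrite ltnS leq_eqVlt -orbA => /orP[pE|//].
by rewrite !inE pE in pq.
Qed.

From mathcomp Require Import all_classical all_reals all_analysis.
From mathcomp Require Import zify ring lra.

Import Order.TTheory GRing.Theory Num.Theory.
Import numFieldNormedType.Exports.

Local Open Scope ring_scope.

(** * The recursion for the proportions *)

Lemma card_perm_ord (n : nat) : #|{: 'S_n}| = n`!.
Proof. by rewrite -[RHS]card_Sn; apply: eq_card => g; rewrite inE. Qed.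

Lemma big_divisors (R : nmodType) (m k : nat) (F : nat -> R) : (0 < m)%N ->
  \sum_(0 <= d < k | (d %| m)%N) F d = \sum_(d <- divisors m | (d < k)%N) F d.
Proof.
move=> m0; rewrite -big_filter -[RHS]big_filter; apply: perm_big.
apply: uniq_perm; rewrite ?filter_uniq ?iota_uniq ?divisors_uniq // => d.
by rewrite !mem_filter mem_index_iota dvdn_divisors // andbC.
Qed.

(** Divide [card_expg_eq1_rec] by the factorial of [n - 1]: each falling factorial then leaves the
    reciprocal of the factorial of [n - d]. *)
Lemma P_rec (R : realType) (n m : nat) : (0 < n)%N -> (0 < m)%N ->
  n%:R * P R n m = \sum_(d <- divisors m | (d <= n)%N) P R (n - d) m.
Proof.
case: n => // n _ m0.
rewrite (eq_bigl (fun d => (d < n.+2)%N)) // -big_divisors //.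
rewrite big_mkcond big_nat_recl //= dvd0n.
rewrite gtn_eqF // add0r big_mkord -big_mkcond /P card_expg_eq1_rec.
rewrite card_perm_ord factS natrM invfM mulrCA mulVKf ?pnatr_eq0 //.
rewrite natr_sum mulr_suml; apply: eq_bigr => d _; rewrite subSS card_perm_ord.
have dn : (d <= n)%N by rewrite -ltnS.
rewrite -[in LHS](ffact_fact dn) !natrM invfM mulrACA divff ?mul1r //.
by rewrite pnatr_eq0 -lt0n ffact_gt0.
Qed.

Lemma P_ge0 (R : realType) (n m : nat) : 0 <= P R n m.
Proof. by rewrite divr_ge0. Qed.

Lemma P_le1 (R : realType) (n m : nat) : P R n m <= 1.
Proof.
rewrite /P card_perm_ord ler_pdivrMr ?ltr0n ?fact_gt0 // mul1r ler_nat.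
by rewrite -card_perm_ord max_card.
Qed.

(** Lagrange: the order of each element divides the order of the group. *)
Lemma P_fact (R : realType) (k m : nat) : (k`! %| m)%N -> P R k m = 1.
Proof.
move=> km; rewrite /P card_perm_ord (_ : [set g | _] = [set: 'S_k]%SET).
  by rewrite cardsT card_perm_ord divff // pnatr_eq0 -lt0n fact_gt0.
apply/setP=> g; rewrite !inE; case/dvdnP: km => q ->; rewrite mulnC expgM.
by rewrite -card_perm_ord -cardsT expg_cardG ?inE // expg1n eqxx.
Qed.

Lemma P_le_divisors (R : realType) (n m : nat) : (0 < n)%N -> (0 < m)%N ->
  P R n m <= (size (divisors m))%:R / n%:R.
Proof.
move=> n0 m0; rewrite ler_pdivlMr ?ltr0n // mulrC P_rec //.
rewrite -sum1_size natr_sum big_mkcond ler_sum // => d _.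
by case: ifP => _; rewrite ?P_le1.
Qed.

(** * Pairs of divisors *)

(** A non-zero [1 - s/a - s/b] is bounded away from 0. Let [a <= b]. If [a >= 4s], it is at least
    1/2. If [a < 4s] and [b >= 8s^2], then [(a - s) b - s a >= b/2]. Otherwise [a b <= 32 s^3],
    while the distance is a non-zero integer. *)
Lemma mul_le_cube_dist (s a b : int) : 0 < s -> s < a -> s < b ->
  a * b != s * a + s * b -> a * b <= 32 * s ^+ 3 * `|a * b - s * a - s * b|.
Proof.
move=> s0 sa sb ne; wlog ab : a b sa sb ne / a <= b.
  move=> H; case/orP: (le_total a b) => ab; first exact: H.
  have := H b a sb sa _ ab; rewrite mulrC [s * b + _]addrC => /(_ ne).
  by rewrite -!addrA [- (s * b) + _]addrC.
have s3 : 1 <= s ^+ 3 by rewrite exprn_ege1 // -gtz0_ge1.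
have D1 : 1 <= `|a * b - s * a - s * b|.
  by rewrite -gtz0_ge1 normr_gt0 -addrA -opprD subr_eq0.
case: (leP (4 * s) a) => a4.
  have D2 : a * b <= 2 * `|a * b - s * a - s * b|.
    apply: le_trans (_ : 2 * (a * b - s * a - s * b) <= _); first by nia.
    by rewrite ler_pM2l // ler_norm.
  apply: le_trans D2 _; apply: ler_wpM2r; lia.
case: (leP (8 * s ^+ 2) b) => b8.
  have D2 : b <= 2 * `|a * b - s * a - s * b|.
    apply: le_trans (_ : 2 * (a * b - s * a - s * b) <= _); first by nia.
    by rewrite ler_pM2l // ler_norm.
  have s1 : s <= s ^+ 3 by rewrite ler_eXnr // -gtz0_ge1.
  nia.
apply: le_trans (_ : 32 * s ^+ 3 <= _); last by rewrite ler_peMr //; lia.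
rewrite exprS; nia.
Qed.

(** With [d = s q / a] and [e = s q / b], the difference [q - d - e] is [q (1 - s/a - s/b)], to
    which [mul_le_cube_dist] applies. If it were negative, its size would be at most [t], against
    the lower bound on [q]. *)
Lemma divisor_pair_gap (s q t d e : nat) :
  (0 < s)%N -> (32 * s ^ 3 * t < q)%N -> (d %| s * q)%N -> (e %| s * q)%N ->
  (d < q)%N -> (e < q)%N -> (d + e <= q + t)%N -> (d + e)%N != q ->
  (d + e < q)%N /\ (q <= 32 * s ^ 3 * (q - (d + e)))%N.
Proof.
move=> s0 tq /dvdnP[a aE] /dvdnP[b bE] dq eq dnt dne.
have q0 : (0 < q)%N by apply: leq_ltn_trans tq.
have sa : (s < a)%N.
  have : (s * d < a * d)%N by rewrite -aE ltn_mul2l s0.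
  by rewrite ltn_mul2r => /andP[].
have sb : (s < b)%N.
  have : (s * e < b * e)%N by rewrite -bE ltn_mul2l s0.
  by rewrite ltn_mul2r => /andP[].
pose X : int := q%:Z - d%:Z - e%:Z.
pose D : int := a%:Z * b%:Z - s%:Z * a%:Z - s%:Z * b%:Z.
have XD : a%:Z * b%:Z * X = q%:Z * D.
  have aE' : s%:Z * q%:Z = a%:Z * d%:Z by rewrite -!PoszM aE.
  have bE' : s%:Z * q%:Z = b%:Z * e%:Z by rewrite -!PoszM bE.
  rewrite /X /D.
  transitivity (a%:Z * b%:Z * q%:Z - b%:Z * (a%:Z * d%:Z)
                - a%:Z * (b%:Z * e%:Z)).
    by ring.
  by rewrite -aE' -bE'; ring.
have ab0 : 0 < a%:Z * b%:Z by nia.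
have X0 : X != 0 by apply: contra dne; rewrite /X; lia.
have D0 : D != 0.
  apply: contra_neq X0 => D0; apply: (mulfI (lt0r_neq0 ab0)).
  by rewrite XD D0 !mulr0.
have key : q%:Z <= 32 * s%:Z ^+ 3 * `|X|.
  have XDn : a%:Z * b%:Z * `|X| = q%:Z * `|D|.
    by rewrite -[in LHS](gtr0_norm ab0) -normrM XD normrM gtr0_norm.
  rewrite -(ler_pM2l ab0) mulrCA XDn mulrCA mulrC.
  rewrite ler_pM2l //; apply: mul_le_cube_dist => //.
  by move: D0; rewrite /D -addrA -opprD subr_eq0.
have S3 : s%:Z ^+ 3 = (s ^ 3)%N%:Z by rewrite -rmorphXn.
case: (ltngtP (d + e)%N q) => [lt|gt|eq']; last by rewrite eq' eqxx in dne.
  split=> //; move: key.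
  rewrite S3 (_ : `|X| = (q - (d + e))%N%:Z); last by lia.
  by lia.
suff : (q <= 32 * s ^ 3 * t)%N by rewrite leqNgt tq.
apply: leq_trans (_ : 32 * s ^ 3 * (d + e - q) <= _)%N; last first.
  by rewrite leq_mul2l leq_subLR dnt orbT.
move: key; rewrite S3 (_ : `|X| = (d + e - q)%N%:Z); last by lia.
by lia.
Qed.

(** * The constants as sums over pairs of divisors *)

Definition pair_sum (R : realType) (s m : nat) : R :=
  \sum_(1 <= u < (s ^ 2).+1)
    \sum_(1 <= v < (s ^ 2).+1 |
        [&& u * v == s ^ 2, s + u %| m & s + v %| m]%N)
      (1 + (u%:R + v%:R) / (2 * s%:R)).

(** The index set is symmetric in [u] and [v], so [(u + v) / 2] may be replaced by [v]. The summand
    becomes [b / s = q / e] for [b = s + v] and [e = s q / b]. *)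
Lemma pair_sum_sym (R : realType) (s m : nat) : (0 < s)%N ->
  pair_sum R s m =
  \sum_(1 <= u < (s ^ 2).+1)
    \sum_(1 <= v < (s ^ 2).+1 |
        [&& u * v == s ^ 2, s + u %| m & s + v %| m]%N) (1 + v%:R / s%:R).
Proof.
move=> s0; have s0R : s%:R != 0 :> R by rewrite pnatr_eq0 -lt0n.
set S := RHS; have SE : S = \sum_(1 <= u < (s ^ 2).+1)
    \sum_(1 <= v < (s ^ 2).+1 |
        [&& u * v == s ^ 2, s + u %| m & s + v %| m]%N) (1 + u%:R / s%:R).
  rewrite /S (exchange_big_dep xpredT) //=; apply: eq_bigr => u _.
  by apply: eq_bigl => v; rewrite mulnC [(s + v %| m)%N && _]andbC.
suff H : 2 * pair_sum R s m = S + S.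
  by apply: (@mulfI _ (2 : R)); rewrite ?pnatr_eq0 // H; ring.
rewrite {1}SE -big_split mulr_sumr; apply: eq_bigr => u _ /=.
rewrite -big_split mulr_sumr; apply: eq_bigr => v _ /=.
by field.
Qed.

Lemma big_seq_pred1_cond (V : nmodType) (I : eqType) (r : seq I) (i : I)
    (F : I -> V) : uniq r ->
  \sum_(j <- r | j == i) F j = if i \in r then F i else 0.
Proof.
move=> r_uniq; case: ifP => ir.
  rewrite big_mkcond (bigD1_seq i) //= eqxx big1 ?addr0 // => j.
  by move/negPf->.
by rewrite big_seq_cond big1 // => j /andP[jr /eqP ji]; rewrite -ji jr in ir.
Qed.

(** Each side is a sum over one variable, since [e = q - d] and [v = s^2 / u]; the substitution
    [d = m / (s + u)] matches them. *)
Lemma sum_divisor_pairs (R : realType) (s q : nat) : (0 < s)%N -> (0 < q)%N ->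
  \sum_(d <- divisors (s * q) | (d < q)%N)
    \sum_(e <- divisors (s * q) | (d + e == q)%N) q%:R / e%:R
  = pair_sum R s (s * q).
Proof.
move=> s0 q0; set m := (s * q)%N; have m0 : (0 < m)%N by rewrite muln_gt0 s0.
have s0R : s%:R != 0 :> R by rewrite pnatr_eq0 -lt0n.
have q0R : q%:R != 0 :> R by rewrite pnatr_eq0 -lt0n.
rewrite pair_sum_sym //.
pose D := [seq d <- divisors m | (d < q)%N && (q - d %| m)%N].
pose U := [seq u <- index_iota 1 (s ^ 2).+1 |
  [&& u %| s ^ 2, s + u %| m & s + s ^ 2 %/ u %| m]%N].
have -> : \sum_(d <- divisors m | (d < q)%N)
    \sum_(e <- divisors m | (d + e == q)%N) q%:R / e%:R =
  \sum_(d <- D) (q%:R / (q - d)%:R : R).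
  rewrite /D big_filter [RHS]big_mkcondr /=.
  apply: eq_bigr => d dq.
  rewrite (eq_bigl (fun e => e == (q - d)%N)); last first.
    by move=> e /=; rewrite -{1}(subnKC (ltnW dq)) eqn_add2l.
  by rewrite big_seq_pred1_cond ?divisors_uniq // -dvdn_divisors.
have -> : \sum_(1 <= u < (s ^ 2).+1)
    \sum_(1 <= v < (s ^ 2).+1 | [&& (u * v)%N == (s ^ 2)%N, (s + u %| m)%N
        & (s + v %| m)%N]) (1 + v%:R / s%:R) =
  \sum_(u <- U) (1 + (s ^ 2 %/ u)%:R / s%:R : R).
  rewrite /U [RHS]big_filter [RHS]big_mkcond /=.
  rewrite [LHS]big_seq_cond [RHS]big_seq_cond; apply: eq_bigr => u.
  rewrite mem_index_iota andbT => /andP[u0 us].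
  have [us2|us2] /= := boolP (u %| s ^ 2)%N; last first.
    rewrite big1 // => v /and3P[/eqP uv _ _]; case/negP: us2.
    by rewrite -uv dvdn_mulr.
  set b := (_ && _).
  rewrite (eq_bigl (fun v => (v == s ^ 2 %/ u)%N && b)); last first.
    move=> v; rewrite /b -[(v == _)](eqn_pmul2l u0).
    rewrite [(u * (_ %/ _))%N]mulnC divnK //.
    case: eqP => //= uv; rewrite -uv mulKn //.
  rewrite big_mkcondr /= big_nat1_eq ltnS leq_div // divn_gt0 //.
  by rewrite dvdn_leq // expn_gt0 s0.
(* For [d = m / (s + u)] the complement [q - d = q u / (s + u)] equals [m / (s + v)] with
   [v = s^2 / u]. *)
have UP u : u \in U -> [/\ (m %/ (s + u) * (s + u) = m)%N,
    (m %/ (s + u) < q)%N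
    & ((s + s ^ 2 %/ u) * (q - m %/ (s + u)) = m)%N].
  rewrite mem_filter mem_index_iota => /andP[/and3P[us2 ud _] /andP[u0 _]].
  have dE : (m %/ (s + u) * (s + u) = m)%N by rewrite divnK.
  have vE : (s ^ 2 %/ u * u = s ^ 2)%N by rewrite divnK.
  move: dE vE; rewrite [in X in _ = X]/m.
  set d := (m %/ _)%N; set v := (_ %/ u)%N => dE vE.
  have dq : (d < q)%N by nia.
  have qd : ((s + u) * (q - d) = q * u)%N by nia.
  split=> //; apply/eqP; rewrite -(eqn_pmul2l u0); apply/eqP.
  transitivity (s * ((s + u) * (q - d)))%N; last by rewrite qd /m; ring.
  by rewrite mulnA mulnDr [(u * v)%N]mulnC vE; ring.
have DU : perm_eq D [seq (m %/ (s + u))%N | u <- U].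
  apply: uniq_perm; first by rewrite filter_uniq ?divisors_uniq.
    rewrite map_inj_in_uniq ?filter_uniq ?iota_uniq // => u u' uU u'U.
    have [dE _ _] := UP u uU; have [dE' _ _] := UP u' u'U => dd.
    move: dE dE'; rewrite -dd; set d := (m %/ _)%N => dE dE'.
    have d0 : (0 < d)%N by case: d dE {dE' dd} m0 => // <-.
    by apply/eqP; rewrite -(eqn_add2l s) -(eqn_pmul2l d0) dE dE'.
  move=> d; apply/idP/mapP=> [|[u uU ->]]; last first.
    have [dE dq vE] := UP u uU.
    rewrite mem_filter dq -dvdn_divisors //=; apply/andP; split.
      by rewrite -{2}vE dvdn_mull.
    by rewrite -{2}dE dvdn_mulr.
  rewrite mem_filter -dvdn_divisors // => /andP[/andP[dq qdm] dm].
  have aE : (m %/ d * d = m)%N by rewrite divnK.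
  have bE : (m %/ (q - d) * (q - d) = m)%N by rewrite divnK.
  have am : (m %/ d %| m)%N by rewrite -{2}aE dvdn_mulr.
  have bm : (m %/ (q - d) %| m)%N by rewrite -{2}bE dvdn_mulr.
  have d0 : (0 < d)%N by rewrite (dvdn_gt0 m0).
  move: aE bE am bm; set a := (m %/ d)%N; set b := (m %/ (q - d))%N.
  move=> aE bE am bm.
  have sa : (s < a)%N by rewrite /m in aE; nia.
  have sb : (s < b)%N by rewrite /m in bE; nia.
  (* Conversely, multiply [q = d + (q - d)] by [a b] and cancel [q]; the result is
     [(a - s)(b - s) = s^2]. *)
  have ab : (a * b = s * a + s * b)%N.
    apply/eqP; rewrite -(eqn_pmul2r q0); apply/eqP.
    transitivity (a * (b * (q - d)) + b * (a * d))%N.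
      rewrite -{1}(subnK (ltnW dq)); ring.
    by rewrite aE bE /m; ring.
  have uv : ((a - s) * (b - s) = s ^ 2)%N by nia.
  have u0 : (0 < a - s)%N by rewrite subn_gt0.
  exists (a - s)%N; last first.
    by rewrite subnKC ?(ltnW sa) // /a -{1}aE mulKn //; lia.
  have vE : (s ^ 2 %/ (a - s) = b - s)%N by rewrite -uv mulKn.
  rewrite mem_filter mem_index_iota vE !subnKC ?(ltnW sa) ?(ltnW sb) // am bm.
  by rewrite -uv dvdn_mulr //= ltnS leq_pmulr ?subn_gt0 ?sb ?sa.
rewrite (perm_big _ DU) big_map big_seq [RHS]big_seq; apply: eq_bigr => u uU.
have [_ dq vE] := UP u uU; move: dq vE.
set d := (m %/ _)%N; set v := (_ %/ u)%N => dq /(congr1 (fun k => k%:R : R)).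
rewrite /m !natrM natrD => vE.
have qd0 : (q - d)%:R != 0 :> R by rewrite pnatr_eq0 subn_eq0 -ltnNge.
apply: (mulIf qd0); rewrite divfK //; apply: (mulfI s0R).
by rewrite -vE; field.
Qed.

(** * The expansion *)

(** A divisor above [q] has cofactor at most [s - 1], so [s q <= (s - 1)(q + t)], which forces
    [q <= (s - 1) t]. *)
Lemma divisor_le (s q t d : nat) :
  (0 < s)%N -> (s * t < q)%N -> (d %| s * q)%N -> (d <= q + t)%N -> (d <= q)%N.
Proof.
move=> s0 tq /dvdnP[a aE] dqt; have [sa|as_] := leqP s a.
  rewrite leqNgt; apply/negP=> qd; nia.
have : (s * q <= s.-1 * (q + t))%N.
  by rewrite aE leq_mul // -ltnS (leq_trans as_) ?leqSpred.
by nia.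
Qed.

(** A divisor below [q] has cofactor at least [s + 1], hence is at most [s q / (s + 1)]. *)
Lemma divisor_lt_gap (s q d : nat) :
  (0 < s)%N -> (d %| s * q)%N -> (d < q)%N -> (q <= s.+1 * (q - d))%N.
Proof.
move=> s0 /dvdnP[a aE] dq; have : (s * d < a * d)%N by rewrite -aE ltn_mul2l s0.
by rewrite ltn_mul2r => /andP[_ sa]; nia.
Qed.

Lemma invr_nat_le (R : realType) (n w a : nat) : (0 < n)%N ->
  (n <= w * a)%N -> a%:R^-1 <= w%:R / n%:R :> R.
Proof.
move=> n0 nwa; have a0 : (0 < a)%N.
  by case: a nwa => //; rewrite muln0 leqNgt n0.
by rewrite ler_pdivlMr ?ltr0n // mulrC ler_pdivrMr ?ltr0n // -natrM ler_nat.
Qed.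

(* The main term of [P (n - d - e) m / (n - d)], where [n = q + t]. *)
Definition pair_main (R : realType) (n q d e : nat) : R :=
  (if e == q then n%:R^-1 else 0) +
  (if (d + e)%N == q then q%:R / e%:R / n%:R else 0).

(** With [w = 2 (s + 1)] one has [n - d >= n / w]. The first summand serves the pairs with a main
    term, the second those without, where [n - d - e >= n / (64 s^3)]. *)
Definition pair_const (s t : nat) : nat :=
  t * (2 * s.+1) ^ 2 + 64 * s ^ 3 * (2 * s.+1).

Lemma P_pair_estimate (R : realType) (s t q d e : nat) :
  (0 < s)%N -> (t`! %| s)%N -> (32 * s ^ 3 * t < q)%N ->
  d \in divisors (s * q) -> e \in divisors (s * q) ->
  (d < q)%N -> (e <= q + t - d)%N ->
  `|P R (q + t - d - e) (s * q) / (q + t - d)%:R - pair_main R (q + t) q d e|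
    <= (pair_const s t * size (divisors (s * q)))%:R / (q + t)%:R ^+ 2.
Proof.
move=> s0 ts tq dD eD dq en; set m := (s * q)%N in dD eD *.
have q0 : (0 < q)%N by apply: leq_ltn_trans tq.
have m0 : (0 < m)%N by rewrite muln_gt0 s0.
have s3 : (s <= s ^ 3)%N by rewrite -{1}(expn1 s) leq_pexp2l.
have stq : (s * t < q)%N by nia.
have tlq : (t <= q)%N by nia.
rewrite -!dvdn_divisors // in dD eD.
have d0 : (0 < d)%N by rewrite (dvdn_gt0 m0).
have e0 : (0 < e)%N by rewrite (dvdn_gt0 m0).
set n := (q + t)%N in en *; have n0 : (0 < n)%N by rewrite addn_gt0 q0.
set w := (2 * s.+1)%N; have qgap := divisor_lt_gap s0 dD dq.
have nw : (n <= w * (q - d))%N by rewrite /n /w; nia.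
have nw' : (n <= w * (n - d))%N.
  by apply: leq_trans nw _; rewrite leq_mul2l leq_sub2r ?leq_addr ?orbT.
have dn : (d < n)%N by rewrite (leq_trans dq) ?leq_addr.
have nR : 0 < n%:R :> R by rewrite ltr0n.
have ndR : 0 < (n - d)%:R :> R by rewrite ltr0n; lia.
set tau := size _; have tau0 : (0 < tau)%N.
  by rewrite /tau; case: (divisors m) (divisor1 m).
have Pt1 k : (k <= t)%N -> P R k m = 1.
  move=> kt; apply: P_fact; apply: dvdn_trans (dvdn_mulr _ ts).
  by rewrite -(ffact_fact (leq_subr k t)) subKn // dvdn_mull.
have K1 (a : R) : a <= (t * w ^ 2)%:R / n%:R ^+ 2 ->
    a <= (pair_const s t * tau)%:R / n%:R ^+ 2.
  move=> /le_trans; apply; rewrite ler_pM2r ?invr_gt0 ?exprn_gt0 // ler_nat.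
  exact: leq_trans (leq_addr _ _) (leq_pmulr _ tau0).
(* Here [t - d] points are left, the proportion is 1, and the error is
   [1/(n - d) - 1/n = d / (n (n - d))]. *)
have [eq|eneq] := eqVneq e q.
  have dt : (d <= t)%N by rewrite /n in en; lia.
  rewrite /pair_main {}eq eqxx (_ : (d + q == q)%N = false) ?addr0; last by lia.
  rewrite Pt1; last by rewrite /n; lia.
  apply: K1.
  have -> : 1 / (n - d)%:R - n%:R^-1 = d%:R / n%:R * (n - d)%:R^-1 :> R.
    rewrite -[in n%:R^-1](subnKC (ltnW dn)) natrD.
    by field; rewrite -natrD subnKC ?(ltnW dn) // !lt0r_neq0.
  rewrite ger0_norm ?mulr_ge0 ?invr_ge0 //.
  apply: le_trans (_ : t%:R / n%:R * (w%:R / n%:R) <= _).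
    rewrite ler_pM ?mulr_ge0 ?invr_ge0 ?invr_nat_le //.
    by rewrite ler_wpM2r ?invr_ge0 ?ler_nat.
  rewrite mulrACA -invfM -expr2 -natrM.
  rewrite ler_wpM2r ?invr_ge0 ?exprn_ge0 // ler_nat.
  by rewrite -mulnn leq_mul2l leq_pmulr ?orbT.
have elt : (e < q)%N.
  by rewrite ltn_neqAle eneq (divisor_le s0 stq eD) // (leq_trans en) ?leq_subr.
(* Here exactly [t] points are left, so the proportion is again 1; [n - d = e + t], and both [e] and
   [n - d] are at least [n / w]. *)
have [deq|deneq] := eqVneq (d + e)%N q.
  rewrite /pair_main (negPf eneq) deq eqxx add0r.
  have -> : (n - d - e)%N = t by rewrite /n -deq; lia.
  rewrite Pt1 //; apply: K1.
  have eR : 0 < e%:R :> R by rewrite ltr0n.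
  have -> : 1 / (n - d)%:R - q%:R / e%:R / n%:R =
      - (t%:R * (d%:R / n%:R) * (e%:R^-1 * (n - d)%:R^-1)) :> R.
    have nE : n%:R = d%:R + e%:R + t%:R :> R by rewrite -!natrD deq.
    have ndE : (n - d)%:R = e%:R + t%:R :> R.
      by rewrite natrB ?(ltnW dn) // nE; ring.
    have qE : q%:R = d%:R + e%:R :> R by rewrite -natrD deq.
    move: nR ndR; rewrite ndE nE qE => nR ndR.
    by field; rewrite !lt0r_neq0.
  rewrite normrN ger0_norm; last by rewrite !mulr_ge0 ?invr_ge0.
  apply: le_trans (_ : t%:R * 1 * (w%:R / n%:R * (w%:R / n%:R)) <= _).
    rewrite ler_pM ?mulr_ge0 ?invr_ge0 //.
      by rewrite ler_wpM2l // ler_pdivrMr // mul1r ler_nat ltnW.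
    rewrite ler_pM ?invr_ge0 // invr_nat_le //.
    by apply: leq_trans nw _; rewrite leq_mul2l -deq; lia.
  by rewrite mulr1 mulrACA -invfM -!expr2 mulrA -[w%:R ^+ 2]natrX -natrM.
rewrite /pair_main (negPf eneq) (negPf deneq) addr0 subr0.
(* No main term: a positive fraction of the points is left, and [P_le_divisors] supplies the factor
   [tau / n]. *)
have [deq kgap] : (d + e < q)%N /\ (q <= 32 * s ^ 3 * (q - (d + e)))%N.
  by apply: (divisor_pair_gap s0 tq) => //; rewrite -/n; lia.
rewrite ger0_norm ?divr_ge0 ?P_ge0 //.
set k := (n - d - e)%N; have k0 : (0 < k)%N by rewrite /k /n; lia.
have nk : (n <= 64 * s ^ 3 * k)%N.
  apply: leq_trans (_ : 2 * q <= _)%N; first by rewrite /n; lia.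
  apply: leq_trans (_ : 64 * s ^ 3 * (q - (d + e)) <= _)%N; first by lia.
  by rewrite leq_mul2l; apply/orP; right; rewrite /k /n; lia.
apply: le_trans (_ : tau%:R / k%:R * (n - d)%:R^-1 <= _).
  by rewrite ler_wpM2r ?invr_ge0 // P_le_divisors.
apply: le_trans (_ : tau%:R * ((64 * s ^ 3)%N%:R / n%:R) * (w%:R / n%:R) <= _).
  rewrite ler_pM ?mulr_ge0 ?invr_ge0 // ?invr_nat_le //.
  by rewrite ler_wpM2l // invr_nat_le.
rewrite [tau%:R * _]mulrA mulrACA -invfM -expr2 -!natrM.
rewrite ler_wpM2r ?invr_ge0 ?exprn_ge0 // ler_nat -mulnA [leqLHS]mulnC.
by rewrite leq_mul2r leq_addl orbT.
Qed.

(** The condition [e = q <= n - d] says [d <= t], and all of 1, ..., [t] divide [m] because [t!]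
    divides [s]; this gives [t / n]. The pairs with [d + e = q] are [sum_divisor_pairs]. *)
Lemma sum_pair_main (R : realType) (s t q : nat) :
  (0 < s)%N -> (t`! %| s)%N -> (t < q)%N ->
  \sum_(d <- divisors (s * q) | (d < q)%N)
    \sum_(e <- divisors (s * q) | (e <= q + t - d)%N) pair_main R (q + t) q d e
  = (t%:R + pair_sum R s (s * q)) / (q + t)%:R.
Proof.
move=> s0 ts tq; have q0 : (0 < q)%N by apply: leq_ltn_trans tq.
set m := (s * q)%N; have m0 : (0 < m)%N by rewrite muln_gt0 s0.
set n := (q + t)%N; rewrite mulrDl -sum_divisor_pairs // -/m mulr_suml.
have -> : t%:R / n%:R = \sum_(d <- divisors m | (d < q)%N)
    (if (d <= t)%N then n%:R^-1 else 0 : R).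
  rewrite -big_mkcondr (eq_bigl (fun d => (d < t.+1)%N)); last first.
    by move=> d /=; rewrite ltnS; lia.
  rewrite -big_divisors // big_mkcond big_ltn //= dvd0n gtn_eqF // add0r.
  rewrite -(big_mkcond (fun d => d %| m)%N) big_nat_cond.
  rewrite (eq_bigl (fun d => (1 <= d < t.+1)%N)); last first.
    move=> d; case: (boolP (1 <= d < t.+1)%N) => //= /andP[d1 dt].
    by rewrite dvdn_mulr // (dvdn_trans (dvdn_fact _) ts) // d1.
  by rewrite -big_nat sumr_const_nat subn1 -[RHS]mulr_natl.
apply/esym; apply: (etrans (esym (big_split _ _ _ _ _))).
rewrite [LHS]big_seq_cond [RHS]big_seq_cond.
apply: eq_bigr => d /andP[dD dq] /=.
rewrite /pair_main big_split /=; congr (_ + _).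
  rewrite -big_mkcondr /=.
  rewrite (eq_bigl (fun e => (e == q) && (d <= t)%N)); last first.
    move=> e; case: eqP => [->|_]; rewrite ?andbF //= andbT /n; lia.
  rewrite big_mkcondr /= big_seq_pred1_cond ?divisors_uniq //.
  by rewrite -dvdn_divisors // dvdn_mull.
rewrite -big_mkcondr /= mulr_suml [LHS]big_seq_cond [RHS]big_seq_cond.
apply: eq_bigl => e; case: eqP => [deq|_]; rewrite ?andbF //= andbT.
by rewrite /n -deq; lia.
Qed.

Lemma P_estimate (R : realType) (s t q : nat) :
  (0 < s)%N -> (t`! %| s)%N -> (32 * s ^ 3 * t < q)%N ->
  `|P R (q + t) (s * q) - ((q + t)%:R^-1
      + (t%:R + pair_sum R s (s * q)) / (q + t)%:R ^+ 2)|
    <= (pair_const s t * size (divisors (s * q)) ^ 3)%:R / (q + t)%:R ^+ 3.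
Proof.
move=> s0 ts tq; have q0 : (0 < q)%N by apply: leq_ltn_trans tq.
have s3 : (s <= s ^ 3)%N by rewrite -{1}(expn1 s) leq_pexp2l.
have stq : (s * t < q)%N by nia.
have tlq : (t < q)%N by nia.
set m := (s * q)%N; have m0 : (0 < m)%N by rewrite muln_gt0 s0.
set n := (q + t)%N; set tau := size _.
have nR : 0 < n%:R :> R by rewrite ltr0n addn_gt0 q0.
(* The divisor [q] leaves [t] points and contributes 1. By [divisor_le] the others are below [q],
   and [P_rec] is applied again to [n - d] points. *)
have nP : n%:R * P R n m = 1 + \sum_(d <- divisors m | (d < q)%N)
    \sum_(e <- divisors m | (e <= n - d)%N) P R (n - d - e) m / (n - d)%:R.
  rewrite P_rec ?addn_gt0 ?q0 // big_mkcond (bigD1_seq q) ?divisors_uniq //=;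
    last by rewrite -dvdn_divisors // dvdn_mull.
  rewrite leq_addr {1}/n addKn P_fact ?(dvdn_trans ts) ?dvdn_mulr //.
  congr (_ + _).
  rewrite -big_mkcondr [LHS]big_seq_cond [RHS]big_seq_cond.
  rewrite (eq_bigl (fun d => (d \in divisors m) && (d < q)%N)); last first.
    move=> d /=; have [dD|//] := boolP (d \in divisors m) => /=.
    rewrite ltn_neqAle; case: eqP => //= _; apply/idP/idP => dn.
      by apply: (divisor_le s0 stq) => //; rewrite dvdn_divisors.
    by rewrite (leq_trans dn) ?leq_addr.
  apply: eq_bigr => d /andP[dD dq]; have nd0 : (0 < n - d)%N by rewrite /n; lia.
  by rewrite -mulr_suml -P_rec // mulrC mulKf // pnatr_eq0 -lt0n.
have -> : P R n m - (n%:R^-1 + (t%:R + pair_sum R s m) / n%:R ^+ 2) =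
    (n%:R * P R n m - 1 - (t%:R + pair_sum R s m) / n%:R) / n%:R.
  by field; rewrite lt0r_neq0.
rewrite normrM [`|_^-1|]ger0_norm ?invr_ge0 //.
rewrite ler_pdivrMr // (exprSr _ 2) invfM.
rewrite [X in _ <= X * _]mulrA divfK ?lt0r_neq0 //.
rewrite nP [1 + _]addrC addrK -sum_pair_main // -sumrB.
apply: le_trans (ler_norm_sum _ _ _) _.
(* There are at most [tau ^ 2] pairs, each with error at most a constant times [tau / n ^ 2]; the
   last factor [1 / n] comes from dividing [n P] by [n]. *)
apply: le_trans (_ : \sum_(d <- divisors m) \sum_(e <- divisors m)
  (pair_const s t * tau)%:R / n%:R ^+ 2 <= _); last first.
  rewrite !big_const_seq !count_predT !iter_addr_0 -/tau -mulrnA.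
  rewrite -[leLHS]mulr_natr mulrAC -natrM.
  rewrite ler_wpM2r ?invr_ge0 ?exprn_ge0 // ler_nat.
  by rewrite !expnS expn0 muln1 -mulnA leqnn.
rewrite big_mkcond /= [leLHS]big_seq [leRHS]big_seq; apply: ler_sum => d dD.
case: ifP => dq; last by rewrite sumr_ge0 // => e _; rewrite divr_ge0.
rewrite -sumrB; apply: le_trans (ler_norm_sum _ _ _) _.
rewrite big_mkcond /= [leLHS]big_seq [leRHS]big_seq; apply: ler_sum => e eD.
case: ifP => en; last by rewrite divr_ge0.
exact: P_pair_estimate.
Qed.

(** * Passage to the asymptotic form *)

Lemma powR52 (R : realType) (n : nat) : (0 < n)%N ->
  n%:R `^ (5 / 2) = n%:R ^+ 2 * Num.sqrt n%:R :> R.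
Proof.
move=> n0; have -> : 5 / 2 = 2%:R + 2^-1 :> R by lra.
rewrite powRD; last by rewrite pnatr_eq0 -lt0n n0 implybT.
by rewrite powR_mulrn // powR12_sqrt.
Qed.

Lemma P_bigO (R : realType) (s t : nat) : (0 < s)%N -> (t`! %| s)%N ->
  bigO_inv_powR_subo (5 / 2) (fun n => P R n (s * (n - t)) -
    (1 / n%:R + (t%:R + pair_sum R s (s * (n - t))) / n%:R ^+ 2)).
Proof.
(* The exponent 6 gives [tau ^ 3 <= sqrt (K m)], and [m <= s n]; so [tau ^ 3 / n ^ 3] is of order
   [n ^ (- 5 / 2)]. *)
move=> s0 ts; have [K KP] := size_divisors_exp_le (isT : (0 < 6)%N).
exists (fun=> 0).
  apply/eqoP => eps eps0; apply: nearW => n.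
  by rewrite normr0 mulr_ge0 // ltW.
apply/eqO_exP.
(* The added 1 makes the constant positive even if [pair_const] or [K] were 0. *)
exists ((pair_const s t)%:R * Num.sqrt (K * s)%:R + 1).
  by rewrite ltr_wpDl ?mulr_ge0 ?sqrtr_ge0.
exists (t + 32 * s ^ 3 * t).+1 => // n /= ntq.
have tn : (t <= n)%N by lia.
have n0 : (0 < n)%N by lia.
have tq : (32 * s ^ 3 * t < n - t)%N by lia.
have := P_estimate R s0 ts tq; rewrite subnK // div1r => /le_trans; apply.
have nR : 0 < n%:R :> R by rewrite ltr0n.
have sn0 : 0 < Num.sqrt n%:R :> R by rewrite sqrtr_gt0.
rewrite subr0 powR52 // div1r ger0_norm ?invr_ge0 ?mulr_ge0 ?sqrtr_ge0 //.
set tau := size _.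
have tauE : (tau ^ 3)%:R <= Num.sqrt (K * s)%:R * Num.sqrt n%:R :> R.
  rewrite -sqrtrM // -natrM -(ger0_norm (ler0n R (tau ^ 3))) -sqrtr_sqr.
  rewrite ler_wsqrtr // -natrX ler_nat -expnM.
  apply: leq_trans (KP _ _) _; first by rewrite muln_gt0 s0; lia.
  by rewrite -mulnA !leq_mul2l leq_subr !orbT.
have n3 : n%:R ^+ 3 = n%:R ^+ 2 * Num.sqrt n%:R * Num.sqrt n%:R :> R.
  by rewrite -mulrA -expr2 sqr_sqrtr // -exprSr.
rewrite ler_pdivrMr ?exprn_gt0 // n3 [leRHS]mulrA mulfVK; last first.
  by rewrite mulf_neq0 ?expf_neq0 ?lt0r_neq0.
rewrite natrM mulrDl mul1r -mulrA ler_wpDr ?sqrtr_ge0 //.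
by rewrite ler_wpM2l.
Qed.

(** The substitution [i = u + 1], [j = v + 1], under which the ranges of summation agree exactly. *)
Lemma c'_pair_sum (R : realType) (r m : nat) : c' R r m = pair_sum R r.+1 m.
Proof.
rewrite /c' /pair_sum addn1 big_add1 /=; apply: eq_bigr => i _.
rewrite big_add1 /=; apply: eq_big => j; first by rewrite !subn1 !addnS !addSn.
move=> _; rewrite natr1 -[i.+1%:R]natr1 -[j.+1%:R]natr1.
by congr (1 + _ / _); ring.
Qed.

Lemma c1E (R : realType) (n : nat) : c R 1 n = if odd n then 0 else 2.
Proof.
rewrite /c exp1n big_nat1 big_mkcond big_nat1 /= mul1n dvdn2.
by case: odd => //=; lra.
Qed.

Theorem theorem1p1 (R : realType) :
  (forall r : nat, (0 < r)%N ->
     bigO_inv_powR_subo (5 / 2)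
       (fun n => P R n (r * n) - (1 / n%:R + c R r n / n%:R ^+ 2)))
  /\ (forall n : nat, (0 < n)%N -> c R 1 n = if odd n then 0 else 2)
  /\ (forall t r : nat, (0 < t)%N -> (0 < r)%N -> r = (t`! - 1)%N ->
     bigO_inv_powR_subo (5 / 2)
       (fun n => let m := (t`! * (n - t))%N in
          P R n m - (1 / n%:R + (t%:R + c' R r m) / n%:R ^+ 2))).
Proof.
split=> [r r0|].
  (* Here [t = 0], and [pair_sum] at [s = r], [m = r n] unfolds to [c]. *)
  have := P_bigO R r0 (dvd1n r : (0`! %| r)%N); congr bigO_inv_powR_subo.
  by apply: funext => n; rewrite subn0 add0r.
split=> [n _|t r _ r0 rt]; first exact: c1E.
have tE : t`! = r.+1 by rewrite rt subn1 prednK ?fact_gt0.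
have := P_bigO R (fact_gt0 t) (dvdnn t`!); congr bigO_inv_powR_subo.
by apply: funext => n /=; rewrite c'_pair_sum -tE.
Qed.
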